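(* Let $f,g\in\mathrm{Diff}(\mathbb{C},0)$ be distinct from the identity and suppose that $f,g$ satisfy no universal relation. Then there exists a set $\mathcal{U}\subseteq\mathrm{Diff}(\mathbb{C},0)$, dense for the analytic topology, such that for every $h\in\mathcal{U}$ the elements $f$ and $h^{-1}\circ g\circ h$ generate a free subgroup of $\mathrm{Diff}(\mathbb{C},0)$.
   Context: $\mathrm{Diff}(\mathbb{C},0)$ is the group of germs of holomorphic diffeomorphisms of $\mathbb{C}$ fixing $0$; $\widehat{\mathrm{Diff}}(\mathbb{C},0)$ is the group of formal series $\sum_{i\ge1}c_ix^i$ with $c_1\neq0$ under formal composition. For a reduced word $W(a,b)$ in $a^{\pm1},b^{\pm1}$, $W(f,g)$ denotes the element obtained by substituting $a=f,b=g$ and composing. A non-trivial reduced word $W(a,b)$ with $W(f,g)=\mathrm{id}$ is called a universal relation (for the pair $f,g$) if $W(f,\hat h^{-1}\circ g\circ\hat h)=\mathrm{id}$ for every $\hat h\in\widehat{\mathrm{Diff}}(\mathbb{C},0)$; ''$f,g$ satisfy no universal relation'' means no non-trivial reduced word is a universal relation. Analytic topology: for $r>0$ and $h$ holomorphic near $0$, $\|h\|_r=\sup_{B(r)}|h|$ if $h$ extends holomorphically to the open disc $B(r)$ of radius $r$, and $+\infty$ otherwise; a basis of open sets is given by $\{g:\|g-f\|_r<\varepsilon\}$, $f\in\mathrm{Diff}(\mathbb{C},0)$, $r,\varepsilon>0$. *)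

(* Defs.v *)
From Stdlib Require Import Reals List ClassicalEpsilon.
From Coquelicot Require Import Coquelicot.
Import ListNotations.
Open Scope R_scope.

Definition fps := nat -> C.

Definition fps_mul (a b : fps) : fps :=
  fun n => sum_n (fun k => Cmult (a k) (b (n - k)%nat)) n.

Definition fps_one : fps := fun n => if Nat.eqb n 0 then RtoC 1 else RtoC 0.

Fixpoint fps_pow (a : fps) (k : nat) : fps :=
  match k with O => fps_one | S k' => fps_mul a (fps_pow a k') end.

Definition fps_id : fps := fun n => if Nat.eqb n 1 then RtoC 1 else RtoC 0.

(** Formal composition F o G (meaningful when G 0 = 0):
    the n-th coefficient is sum_{k<=n} F_k [x^n] G^k. *)
Definition fps_comp (F G : fps) : fps :=
  fun n => sum_n (fun k => Cmult (F k) (fps_pow G k n)) n.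

Definition is_formal_diff (F : fps) : Prop := F 0%nat = RtoC 0 /\ F 1%nat <> RtoC 0.

(** Compositional inverse (the unique two-sided inverse when F is in the group). *)
Definition fps_inv (F : fps) : fps :=
  epsilon (inhabits fps_id)
    (fun G => is_formal_diff G /\ fps_comp F G = fps_id /\ fps_comp G F = fps_id).

Definition series_at (F : fps) (z l : C) : Prop :=
  is_series (fun n => Cmult (F n) (Cpow z n)) l.

Definition is_germ (F : fps) : Prop :=
  is_formal_diff F /\
  exists rho, 0 < rho /\ forall z : C, Cmod z < rho -> exists l, series_at F z l.

Inductive letter := LA | LAinv | LB | LBinv.

Definition word := list letter.

Definition inverse_letters (x y : letter) : bool :=
  match x, y with
  | LA, LAinv | LAinv, LA | LB, LBinv | LBinv, LB => true
  | _, _ => false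
  end.

Fixpoint reduced (w : word) : Prop :=
  match w with
  | [] => True
  | x :: w' =>
      match w' with
      | [] => True
      | y :: _ => inverse_letters x y = false /\ reduced w'
      end
  end.

Definition letter_val (f g : fps) (x : letter) : fps :=
  match x with
  | LA => f | LAinv => fps_inv f | LB => g | LBinv => fps_inv g
  end.

Definition eval_word (f g : fps) (w : word) : fps :=
  fold_right (fun x acc => fps_comp (letter_val f g x) acc) fps_id w.

Definition conjug (h g : fps) : fps := fps_comp (fps_inv h) (fps_comp g h).

Definition universal_relation (f g : fps) (W : word) : Prop :=
  reduced W /\ W <> [] /\ eval_word f g W = fps_id /\
  forall h, is_formal_diff h -> eval_word f (conjug h g) W = fps_id.

Definition no_universal_relation (f g : fps) : Prop :=
  forall W, ~ universal_relation f g W.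

(** Basic open set {g : ||g - f||_r < eps} of the analytic topology:
    g - f extends holomorphically to B(r) (its power series converges on B(r))
    and sup_{B(r)} |g - f| < eps. *)
Definition analytic_ball (f : fps) (r eps : R) (g : fps) : Prop :=
  let d := fun n => Cminus (g n) (f n) in
  (forall z : C, Cmod z < r -> exists l, series_at d z l) /\
  exists M, M < eps /\
    forall z l, Cmod z < r -> series_at d z l -> Cmod l <= M.

Definition analytic_dense (U : fps -> Prop) : Prop :=
  forall f r eps, is_germ f -> 0 < r -> 0 < eps ->
    exists h, U h /\ is_germ h /\ analytic_ball f r eps h.

Definition free_pair (f k : fps) : Prop :=
  forall W : word, reduced W -> W <> [] -> eval_word f k W <> fps_id.

(* Main.v *)
(** The coefficients of [h] are chosen one at a time, each arbitrarily close to that of the germ to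
    be approximated. For every reduced word [W], the choices made so far keep some formal
    completion violating the relation [W], at a coefficient of order [N W] fixed at the start;
    before any choice this is the absence of universal relations. Replacing the next coefficient
    of such a completion by a variable [s] turns the coefficient of order [N W] into a rational
    function of [s] that is not identically zero, so each word excludes finitely many values of [s],
    and the countably many words leave some value free. In the limit, [h] has the same first
    [N W] coefficients as a completion violating [W], hence violates [W] too. *)

Require Import Defs.
From Stdlib Require Import Reals List.
From Coquelicot Require Import Coquelicot.
From Stdlib Require Import Lia Lra Wf_nat FunctionalExtensionality ClassicalEpsilon Cantor.
Import ListNotations.
Open Scope C_scope.

(* [sum_n] has type the carrier of [C_AbelianMonoid], which [ring] does not see as [C]. *)
Ltac cring :=
  lazymatch goal with |- ?a = ?b => change (@eq C a b) end;
  repeat match goal with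
  | |- context [@sum_n ?G ?a ?n] =>
      let x := fresh in pose (x := @sum_n G a n : C); change (@sum_n G a n) with x; clearbody x
  end; ring.

(** * Products and composition of power series *)

Lemma Csum_O (a : nat -> C) : sum_n a 0 = a 0%nat.
Proof. exact (sum_O a). Qed.

Lemma Csum_S (a : nat -> C) n : sum_n a (S n) = sum_n a n + a (S n).
Proof. exact (sum_Sn a n). Qed.

Lemma Csum_ext_loc (a b : nat -> C) n :
  (forall k, (k <= n)%nat -> a k = b k) -> sum_n a n = sum_n b n.
Proof. exact (sum_n_ext_loc a b n). Qed.

Lemma Csum_head (a : nat -> C) n :
  sum_n a (S n) = a 0%nat + sum_n (fun k => a (S k)) n.
Proof.
  induction n as [|n IH]; rewrite Csum_S.
  - now rewrite !Csum_O.
  - rewrite IH, (Csum_S (fun k => a (S k))). cring.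
Qed.

Lemma Csum_scal (c : C) (a : nat -> C) n :
  sum_n (fun k => c * a k) n = c * sum_n a n.
Proof.
  induction n as [|n IH]; [now rewrite !Csum_O|].
  rewrite !Csum_S, IH. cring.
Qed.

Lemma Csum_plus (a b : nat -> C) n :
  sum_n (fun k => a k + b k) n = sum_n a n + sum_n b n.
Proof.
  induction n as [|n IH]; [now rewrite !Csum_O|].
  rewrite !Csum_S, IH. cring.
Qed.

Lemma Csum_zero (a : nat -> C) n :
  (forall k, (k <= n)%nat -> a k = 0) -> sum_n a n = RtoC 0.
Proof.
  intros H. induction n as [|n IH]; [rewrite Csum_O; apply H; lia|].
  rewrite Csum_S, IH, H by (intros; try apply H; lia). cring.
Qed.

Definition shift (F : fps) : fps := fun n => F (S n).

Lemma fps_mul_O (a b : fps) : fps_mul a b 0%nat = a 0%nat * b 0%nat.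
Proof. unfold fps_mul. now rewrite Csum_O. Qed.

Lemma fps_mul_S (a b : fps) n :
  fps_mul a b (S n) = a 0%nat * b (S n) + fps_mul (shift a) b n.
Proof. unfold fps_mul. now rewrite Csum_head. Qed.

(** Splitting off the last term instead of the first gives a mirror image of [fps_mul_S], so both
    products obey the same recursion in [n]. *)
Lemma fps_mul_comm (a b : fps) n : fps_mul a b n = fps_mul b a n.
Proof.
  assert (H : forall (a b : fps) n, 
     fps_mul a b (S n) = a (S n) * b 0%nat + fps_mul a (shift b) n).
  { intros u v m. unfold fps_mul. rewrite Csum_S, Nat.sub_diag, Cplus_comm.
    f_equal. apply Csum_ext_loc. intros k Hk. unfold shift.
    now replace (S m - k)%nat with (S (m - k)) by lia. }
  revert a b. induction n as [|n IH]; intros a b.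
  - rewrite !fps_mul_O. cring.
  - rewrite fps_mul_S, H, IH. cring.
Qed.

Lemma fps_mul_scal_plus_l (c : C) (a b d : fps) n :
  fps_mul (fun k => c * a k + b k) d n = c * fps_mul a d n + fps_mul b d n.
Proof.
  unfold fps_mul. rewrite <- Csum_scal, <- Csum_plus.
  apply Csum_ext_loc. intros. cring.
Qed.

Lemma fps_mul_assoc (a b c : fps) n :
  fps_mul a (fps_mul b c) n = fps_mul (fps_mul a b) c n.
Proof.
  revert a b c. induction n as [|n IH]; intros a b c.
  - rewrite !fps_mul_O. cring.
  - rewrite !fps_mul_S, IH, fps_mul_O.
    replace (shift (fps_mul a b))
      with (fun k => a 0%nat * shift b k + fps_mul (shift a) b k)
      by (apply functional_extensionality; intros k; symmetry; apply fps_mul_S).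
    rewrite fps_mul_scal_plus_l. cring.
Qed.

Lemma fps_mul_one (a : fps) n : fps_mul a fps_one n = a n.
Proof.
  rewrite fps_mul_comm. destruct n as [|n].
  - rewrite fps_mul_O. unfold fps_one; simpl. cring.
  - rewrite fps_mul_S.
    unfold fps_mul. rewrite Csum_zero.
    + unfold fps_one; simpl. cring.
    + intros. unfold shift, fps_one; simpl. cring.
Qed.

(** Congruence modulo [x^(N+1)]. The group operations respect it, so a coefficient of a word in [f]
    and the conjugate depends on finitely many coefficients of [h]. *)
Definition agree (N : nat) (A B : fps) : Prop := forall n, (n <= N)%nat -> A n = B n.

Lemma agree_mul N A A' B B' :
  agree N A A' -> agree N B B' -> agree N (fps_mul A B) (fps_mul A' B').
Proof.
  intros HA HB n Hn. apply Csum_ext_loc. intros k Hk.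
  rewrite HA, HB by lia. reflexivity.
Qed.

Lemma agree_pow N A A' k : agree N A A' -> agree N (fps_pow A k) (fps_pow A' k).
Proof.
  intros HA. induction k as [|k IH]; [easy|]. now apply agree_mul.
Qed.

Lemma agree_comp N F F' G G' :
  agree N F F' -> agree N G G' -> agree N (fps_comp F G) (fps_comp F' G').
Proof.
  intros HF HG n Hn. apply Csum_ext_loc. intros k Hk.
  rewrite (HF k), (agree_pow N G G' k HG n) by lia. reflexivity.
Qed.

Lemma fps_mul_lead (G A : fps) n c :
  G 0%nat = 0 -> (forall m, (m < n)%nat -> A m = 0) -> A n = c ->
  (forall m, (m < S n)%nat -> fps_mul G A m = 0) /\ fps_mul G A (S n) = G 1%nat * c.
Proof.
  intros HG HA Hc. split.
  - intros m Hm. apply Csum_zero. intros [|k] Hk.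
    + rewrite HG. cring.
    + rewrite (HA (m - S k)%nat) by lia. cring.
  - rewrite fps_mul_comm. unfold fps_mul. rewrite Csum_S, Nat.sub_diag, HG.
    destruct n as [|n].
    + rewrite Csum_O, Hc. simpl. cring.
    + rewrite Csum_S, Csum_zero.
      * replace (S (S n) - S n)%nat with 1%nat by lia. rewrite Hc. cring.
      * intros k Hk. rewrite HA by lia. cring.
Qed.

Lemma fps_pow_lead (G : fps) k :
  G 0%nat = 0 ->
  (forall n, (n < k)%nat -> fps_pow G k n = 0) /\ fps_pow G k k = G 1%nat ^ k.
Proof.
  intros HG. induction k as [|k [IH1 IH2]].
  - split; [lia|]. reflexivity.
  - simpl. now apply fps_mul_lead.
Qed.

Lemma fps_pow_low (G : fps) k n : G 0%nat = 0 -> (n < k)%nat -> fps_pow G k n = 0.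
Proof. intros HG. apply fps_pow_lead, HG. Qed.

Lemma fps_pow_diag (G : fps) n : G 0%nat = 0 -> fps_pow G n n = G 1%nat ^ n.
Proof. intros HG. now apply fps_pow_lead. Qed.

(** The added terms vanish because [G^k] starts at order [k]. A range of summation independent of
    [n] allows sums and products to be exchanged. *)
Lemma fps_comp_wide (F G : fps) n N : G 0%nat = 0 -> (n <= N)%nat ->
  fps_comp F G n = sum_n (fun k => F k * fps_pow G k n) N.
Proof.
  intros HG. induction N as [|N IH]; intros Hn.
  - now replace n with 0%nat by lia.
  - destruct (Nat.eq_dec n (S N)) as [->|Hne]; [reflexivity|].
    rewrite Csum_S, fps_pow_low, IH by (trivial; lia). cring.
Qed.

Lemma Csum_mul_swap (G : fps) (c : nat -> C) (B : nat -> fps) n N :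
  sum_n (fun k => c k * fps_mul G (B k) n) N
  = fps_mul G (fun m => sum_n (fun k => c k * B k m) N) n.
Proof.
  induction N as [|N IH].
  - rewrite Csum_O. rewrite (fps_mul_comm G), (fps_mul_comm G).
    unfold fps_mul at 1. rewrite <- Csum_scal. apply Csum_ext_loc.
    intros k _. rewrite Csum_O. cring.
  - rewrite Csum_S, IH.
    rewrite !(fps_mul_comm G). rewrite Cplus_comm, <- fps_mul_scal_plus_l.
    apply agree_mul with n; [|easy|lia].
    intros m _. rewrite Csum_S. cring.
Qed.

(* Horner's rule: since [G] has no constant term, it turns identities between compositions
   into inductions on the order of the coefficient. *)
Lemma fps_comp_horner (F G : fps) n : G 0%nat = 0 ->
  fps_comp F G n = F 0%nat * fps_one n + fps_mul G (fps_comp (shift F) G) n.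
Proof.
  intros HG.
  rewrite (fps_comp_wide F G n (S n) HG) by lia. rewrite Csum_head. f_equal.
  change (sum_n (fun k => shift F k * fps_mul G (fps_pow G k) n) n
   = fps_mul G (fps_comp (shift F) G) n).
  rewrite Csum_mul_swap. apply agree_mul with n; [easy| |lia].
  intros m Hm. symmetry. now apply fps_comp_wide.
Qed.

(** Multiplying by [G] raises orders; this makes strong induction on [n] work after Horner's
    rule. *)
Lemma fps_mul_ext_lt (G A B : fps) n : G 0%nat = 0 ->
  (forall m, (m < n)%nat -> A m = B m) -> fps_mul G A n = fps_mul G B n.
Proof.
  intros HG H. apply Csum_ext_loc. intros [|k] Hk.
  - rewrite HG. cring.
  - rewrite H by lia. reflexivity.
Qed.

Lemma fps_comp_O (F G : fps) : fps_comp F G 0%nat = F 0%nat.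
Proof. unfold fps_comp. rewrite Csum_O. unfold fps_pow, fps_one. simpl. cring. Qed.

Lemma fps_comp_scal_plus (c : C) (a b G : fps) n :
  fps_comp (fun k => c * a k + b k) G n = c * fps_comp a G n + fps_comp b G n.
Proof.
  unfold fps_comp. rewrite <- Csum_scal, <- Csum_plus.
  apply Csum_ext_loc. intros. cring.
Qed.

(** Horner's rule leaves [G] times the composition of [shift (fps_mul A B)] with [G], seen only
    below order [n]. There the shift splits as [A 0] times [shift B] plus [shift A] times [B], and
    induction applies to the last product. *)
Lemma fps_comp_mul (A B G : fps) n : G 0%nat = 0 ->
  fps_comp (fps_mul A B) G n = fps_mul (fps_comp A G) (fps_comp B G) n.
Proof.
  intros HG. revert A B. induction n as [n IH] using lt_wf_ind. intros A B.
  rewrite fps_comp_horner by trivial.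
  rewrite (fps_mul_ext_lt G _
    (fun m => A 0%nat * fps_comp (shift B) G m
      + fps_mul (fps_comp (shift A) G) (fps_comp B G) m)); trivial.
  2:{ intros m Hm. rewrite <- IH by lia. rewrite <- fps_comp_scal_plus.
      apply agree_comp with m; [|easy|lia]. intros j _. apply fps_mul_S. }
  rewrite (fps_mul_comm G), fps_mul_scal_plus_l, fps_mul_O.
  rewrite !(fps_mul_comm _ G), fps_mul_assoc.
  transitivity (fps_mul (fun m => A 0%nat * fps_one m
     + fps_mul G (fps_comp (shift A) G) m) (fps_comp B G) n).
  - rewrite fps_mul_scal_plus_l, (fps_mul_comm fps_one), fps_mul_one.
    rewrite (fps_comp_horner B G) by trivial. cring.
  - apply agree_mul with n; [|easy|lia].
    intros m _. symmetry. now apply fps_comp_horner.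
Qed.

(** Horner's rule for the inner series [fps_comp G H] reduces to [shift F] at lower orders;
    multiplicativity of composition then reassembles Horner's rule for [fps_comp F G]. *)
Lemma fps_comp_assoc (F G H : fps) : G 0%nat = 0 -> H 0%nat = 0 ->
  fps_comp (fps_comp F G) H = fps_comp F (fps_comp G H).
Proof.
  intros HG HH. apply functional_extensionality. intros n.
  revert F. induction n as [n IH] using lt_wf_ind. intros F.
  assert (HK : fps_comp G H 0%nat = 0) by now rewrite fps_comp_O.
  rewrite (fps_comp_horner F (fps_comp G H)) by trivial.
  rewrite <- (fps_mul_ext_lt _ (fps_comp (fps_comp (shift F) G) H));
    [|trivial|intros; now apply IH].
  rewrite <- fps_comp_mul by trivial.
  transitivity (fps_comp (fun k => F 0%nat * fps_one k
     + fps_mul G (fps_comp (shift F) G) k) H n).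
  - apply agree_comp with n; [|easy|lia]. intros m _. now apply fps_comp_horner.
  - rewrite fps_comp_scal_plus. f_equal. f_equal.
    (* It remains to compose the constant series [fps_one] with [H]; its shift is zero. *)
    rewrite fps_comp_horner by trivial.
    rewrite (fps_mul_ext_lt H _ (fun _ => 0)); trivial.
    + unfold fps_mul. rewrite Csum_zero by (intros; cring).
      unfold fps_one; simpl. cring.
    + intros m _. apply Csum_zero. intros k _. unfold shift, fps_one; simpl. cring.
Qed.

Lemma fps_comp_id_l (F : fps) : F 0%nat = 0 -> fps_comp fps_id F = F.
Proof.
  intros HF. apply functional_extensionality. intros n.
  rewrite (fps_comp_wide _ _ n (S n)) by (trivial; lia). rewrite Csum_head.
  rewrite (Csum_ext_loc _ (fun k => fps_one k * fps_pow F (S k) n)) by reflexivity.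
  destruct n as [|n].
  - rewrite Csum_O. simpl. rewrite fps_mul_one. unfold fps_id, fps_one; simpl. cring.
  - rewrite Csum_head, Csum_zero.
    + simpl. rewrite fps_mul_one. unfold fps_id, fps_one; simpl. cring.
    + intros k _. unfold fps_one; simpl. cring.
Qed.

Lemma fps_pow_id k n : fps_pow fps_id k n = if Nat.eqb n k then 1 else 0.
Proof.
  revert n. induction k as [|k IH]; intros n; [reflexivity|].
  simpl fps_pow. destruct n as [|n].
  - rewrite fps_mul_O. unfold fps_id; simpl. cring.
  - rewrite fps_mul_S. change (shift fps_id) with fps_one.
    rewrite fps_mul_comm, fps_mul_one, (IH n). change (fps_id 0%nat) with (RtoC 0). simpl Nat.eqb. cring.
Qed.

Lemma fps_comp_id_r (F : fps) : fps_comp F fps_id = F.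
Proof.
  apply functional_extensionality. intros n. unfold fps_comp.
  destruct n as [|n].
  - rewrite Csum_O. simpl. unfold fps_one; simpl. cring.
  - rewrite Csum_S, Csum_zero, fps_pow_id, Nat.eqb_refl. cring.
    intros k Hk. rewrite fps_pow_id.
    destruct (Nat.eqb_spec (S n) k); [lia|]. cring.
Qed.

(** * Compositional inverses *)

Definition trunc (n : nat) (G : fps) : fps := fun k => if Nat.ltb k n then G k else 0.

(** The top coefficient of [G] enters linearly with factor [F 1 ^ n]. When [F 1] is nonzero, a left
    inverse can thus be solved for coefficient by coefficient. *)
Lemma fps_comp_trunc (G F : fps) n : F 0%nat = 0 ->
  fps_comp G F n = fps_comp (trunc n G) F n + G n * F 1%nat ^ n.
Proof.
  intros HF. unfold fps_comp.
  assert (Hlt : forall k, (k < n)%nat -> trunc n G k = G k)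
    by (intros k Hk; unfold trunc; now rewrite (proj2 (Nat.ltb_lt k n) Hk)).
  assert (Hn : trunc n G n = 0) by (unfold trunc; now rewrite Nat.ltb_irrefl).
  destruct n as [|n].
  - rewrite !Csum_O, Hn. unfold fps_pow, fps_one; simpl. cring.
  - rewrite !Csum_S, Hn, fps_pow_diag by trivial.
    rewrite (Csum_ext_loc (fun k => trunc (S n) G k * _) (fun k => G k * fps_pow F k (S n)))
      by (intros k Hk; now rewrite Hlt by lia).
    cring.
Qed.

Lemma fps_comp_1 (G F : fps) : F 0%nat = 0 -> fps_comp G F 1%nat = G 1%nat * F 1%nat.
Proof.
  intros HF. unfold fps_comp. rewrite Csum_S, Csum_O, fps_pow_diag by trivial.
  unfold fps_pow, fps_one; simpl. cring.
Qed.

Lemma is_formal_diff_id : is_formal_diff fps_id.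
Proof. split; [reflexivity|]. exact C1_nz. Qed.

Lemma is_formal_diff_comp F G :
  is_formal_diff F -> is_formal_diff G -> is_formal_diff (fps_comp F G).
Proof.
  intros [F0 F1] [G0 G1]. split.
  - now rewrite fps_comp_O.
  - rewrite fps_comp_1 by trivial. now apply Cmult_neq_0.
Qed.

Fixpoint left_inverse_upto (F : fps) (n : nat) : fps :=
  match n with
  | O => fun _ => 0
  | S m => fun k => if Nat.eqb k m
      then (fps_id m - fps_comp (left_inverse_upto F m) F m) / F 1%nat ^ m
      else left_inverse_upto F m k
  end.

Lemma fps_left_inverse F : is_formal_diff F ->
  exists G, is_formal_diff G /\ fps_comp G F = fps_id.
Proof.
  intros [F0 F1]. set (G := fun n => left_inverse_upto F (S n) n).
  assert (HG : forall n k, left_inverse_upto F n k = trunc n G k).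
  { induction n as [|n IH]; intros k; [reflexivity|].
    unfold trunc. destruct (Nat.ltb_spec k (S n)) as [Hk|Hk].
    - destruct (Nat.eq_dec k n) as [->|Hne]; [reflexivity|].
      simpl. destruct (Nat.eqb_spec k n); [lia|]. rewrite IH. unfold trunc.
      destruct (Nat.ltb_spec k n); [reflexivity|lia].
    - simpl. destruct (Nat.eqb_spec k n); [lia|]. rewrite IH. unfold trunc.
      destruct (Nat.ltb_spec k n); [lia|reflexivity]. }
  assert (HGF : fps_comp G F = fps_id).
  { apply functional_extensionality. intros n.
    rewrite fps_comp_trunc by trivial.
    replace (G n) with ((fps_id n - fps_comp (trunc n G) F n) / F 1%nat ^ n).
    - field. now apply Cpow_nz.
    - unfold G at 2; simpl. rewrite Nat.eqb_refl. do 2 f_equal.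
      f_equal. f_equal. apply functional_extensionality. intros; symmetry; apply HG. }
  exists G. repeat split; trivial.
  - rewrite <- (fps_comp_O G F), HGF. reflexivity.
  - intros H. apply C1_nz. change (fps_id 1%nat = 0).
    rewrite <- HGF, fps_comp_1, H by trivial. cring.
Qed.

(** A left inverse [G] has itself a left inverse [H], and associativity forces [H = F]. So [G] is
    two-sided and witnesses the [epsilon] in [fps_inv]. *)
Lemma fps_inv_spec F : is_formal_diff F ->
  is_formal_diff (fps_inv F) /\
  fps_comp F (fps_inv F) = fps_id /\ fps_comp (fps_inv F) F = fps_id.
Proof.
  intros HF. unfold fps_inv. apply epsilon_spec.
  destruct (fps_left_inverse F HF) as [G [HG HGF]].
  destruct (fps_left_inverse G HG) as [H [HH HHG]].
  exists G. repeat split; try apply HG; trivial.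
  replace F with H; trivial.
  rewrite <- (fps_comp_id_r H), <- HGF, <- fps_comp_assoc, HHG.
  - apply fps_comp_id_l, HF.
  - apply HG.
  - apply HF.
Qed.

(** A recursion through lower coefficients of the inverse and [/ F 1] alone; it yields both the
    agreement and the rationality of inverses. *)
Lemma fps_inv_coef F n : is_formal_diff F ->
  fps_inv F n = (fps_id n - fps_comp (trunc n (fps_inv F)) F n) * (/ F 1%nat) ^ n.
Proof.
  intros HF. destruct (fps_inv_spec F HF) as [_ [_ H]]. destruct HF as [F0 F1].
  rewrite <- H, (fps_comp_trunc _ F n), Cpow_inv by trivial. field. now apply Cpow_nz.
Qed.

Lemma fps_inv_1 F : is_formal_diff F -> fps_inv F 1%nat = / F 1%nat.
Proof.
  intros HF. destruct (fps_inv_spec F HF) as [_ [_ H]]. destruct HF as [F0 F1].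
  apply (f_equal (fun G => G 1%nat)) in H.
  rewrite fps_comp_1 in H by trivial. change (fps_id 1%nat) with (RtoC 1) in H.
  replace (/ F 1%nat) with (1 * / F 1%nat) by cring. rewrite <- H. now field.
Qed.

Lemma agree_inv N F F' : is_formal_diff F -> is_formal_diff F' ->
  agree N F F' -> agree N (fps_inv F) (fps_inv F').
Proof.
  intros HF HF' H n. induction n as [n IH] using lt_wf_ind. intros Hn.
  rewrite !fps_inv_coef by trivial.
  rewrite (agree_comp n (trunc n (fps_inv F)) (trunc n (fps_inv F')) F F' ); trivial.
  - destruct n as [|n]; [reflexivity|]. now rewrite (H 1%nat) by lia.
  - intros k Hk. unfold trunc. destruct (Nat.ltb_spec k n); trivial. apply IH; lia.
  - intros k Hk. apply H. lia.
Qed.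

(** * Conjugation and evaluation of words *)

Lemma is_formal_diff_conjug h g :
  is_formal_diff h -> is_formal_diff g -> is_formal_diff (conjug h g).
Proof.
  intros Hh Hg. apply is_formal_diff_comp; [now apply fps_inv_spec|].
  now apply is_formal_diff_comp.
Qed.

(** The linear coefficient is multiplicative under composition, hence a conjugacy invariant. *)
Lemma conjug_1 h g : is_formal_diff h -> is_formal_diff g ->
  conjug h g 1%nat = g 1%nat.
Proof.
  intros Hh Hg. unfold conjug.
  rewrite !fps_comp_1, fps_inv_1; trivial; try apply Hh.
  - field. apply Hh.
  - rewrite fps_comp_O. apply Hg.
Qed.

Lemma conjug_id g : is_formal_diff g -> conjug fps_id g = g.
Proof.
  intros Hg. unfold conjug.
  destruct (fps_inv_spec fps_id is_formal_diff_id) as [_ [_ H]].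
  rewrite fps_comp_id_r in H. rewrite H, fps_comp_id_r.
  apply fps_comp_id_l, Hg.
Qed.

Lemma agree_conjug N h h' g : is_formal_diff h -> is_formal_diff h' ->
  agree N h h' -> agree N (conjug h g) (conjug h' g).
Proof.
  intros Hh Hh' H. apply agree_comp; [now apply agree_inv|].
  now apply agree_comp.
Qed.

Lemma agree_eval N f k k' W : is_formal_diff k -> is_formal_diff k' ->
  agree N k k' -> agree N (eval_word f k W) (eval_word f k' W).
Proof.
  intros Hk Hk' H. induction W as [|x W IH]; simpl; [easy|].
  apply agree_comp; trivial. destruct x; simpl; trivial; try easy. now apply agree_inv.
Qed.

(** * Rational dependence on one parameter *)

Fixpoint peval (p : list C) (x : C) : C :=
  match p with [] => 0 | a :: q => a + x * peval q x end.

Definition is_poly (f : C -> C) : Prop := exists p, forall x, f x = peval p x.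

Lemma is_poly_const c : is_poly (fun _ => c).
Proof. exists [c]. intros x. simpl. cring. Qed.

Lemma is_poly_id : is_poly (fun x => x).
Proof. exists [RtoC 0; RtoC 1]. intros x. simpl. cring. Qed.

Lemma is_poly_plus f g : is_poly f -> is_poly g -> is_poly (fun x => f x + g x).
Proof.
  intros [p Hp] [q Hq].
  assert (H : exists r, forall x, peval p x + peval q x = peval r x).
  { clear f g Hp Hq. revert q. induction p as [|a p IH]; intros q.
    - exists q. intros x. simpl. cring.
    - destruct q as [|b q].
      + exists (a :: p). intros x. simpl. cring.
      + destruct (IH q) as [r Hr]. exists (a + b :: r). intros x. simpl.
        rewrite <- Hr. cring. }
  destruct H as [r Hr]. exists r. intros x. now rewrite Hp, Hq.
Qed.

Lemma is_poly_mult f g : is_poly f -> is_poly g -> is_poly (fun x => f x * g x).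
Proof.
  intros [p Hp] Hg.
  assert (H : is_poly (fun x => peval p x * g x)).
  { clear f Hp. induction p as [|a p IH].
    - exists []. intros x. simpl. cring.
    - assert (H1 : is_poly (fun x => a * g x)).
      { clear IH. destruct Hg as [q Hq]. exists (map (Cmult a) q). intros x. rewrite Hq.
        clear. induction q as [|b q IH]; simpl; [cring|]. rewrite <- IH. cring. }
      assert (H2 : is_poly (fun x => x * (peval p x * g x))).
      { destruct IH as [q Hq]. exists (RtoC 0 :: q). intros x. simpl. rewrite Hq. cring. }
      destruct (is_poly_plus _ _ H1 H2) as [r Hr]. exists r. intros x.
      rewrite <- Hr. simpl. cring. }
  destruct H as [r Hr]. exists r. intros x. now rewrite Hp.
Qed.

Lemma is_poly_pow f n : is_poly f -> is_poly (fun x => f x ^ n).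
Proof.
  intros Hf. induction n as [|n IH]; [exact (is_poly_const 1)|].
  exact (is_poly_mult _ _ Hf IH).
Qed.

(** Synthetic division by [x - b]. The quotient is one coefficient shorter than [a :: p], the
    measure used for counting roots. *)
Lemma peval_factor a p b : exists q, length q = length p /\
  forall x, peval (a :: p) x = peval (a :: p) b + (x - b) * peval q x.
Proof.
  revert a. induction p as [|c p IH]; intros a.
  - exists []. split; trivial. intros x. simpl. cring.
  - destruct (IH c) as [q [Hl Hq]]. exists (peval (c :: p) b :: q).
    split; [simpl; now rewrite Hl|]. intros x.
    change (a + x * peval (c :: p) x = a + b * peval (c :: p) b
       + (x - b) * (peval (c :: p) b + x * peval q x)).
    rewrite Hq. cring.
Qed.

(** Dividing out one root leaves a shorter polynomial that is still nonzero at [a], so the process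
    ends. *)
Lemma is_poly_roots f a : is_poly f -> f a <> 0 ->
  exists L, forall x, f x = 0 -> In x L.
Proof.
  intros [p Hp] Ha. rewrite Hp in Ha.
  assert (H : exists L, forall x, peval p x = 0 -> In x L).
  { clear f Hp. remember (length p) as n eqn:Hn. revert p Hn Ha.
    induction n as [|n IH]; intros [|c p] Hn Ha; simpl in Hn; try discriminate.
    - now destruct Ha.
    - destruct (excluded_middle_informative (exists b, peval (c :: p) b = 0)) as [[b Hb]|Hno].
      + destruct (peval_factor c p b) as [q [Hl Hq]].
        destruct (IH q) as [L HL]; [lia| |].
        * intros H0. apply Ha. rewrite Hq, Hb, H0. cring.
        * exists (b :: L). intros x Hx.
          destruct (excluded_middle_informative (x = b)) as [->|Hxb]; [now left|].
          right. apply HL. apply NNPP. intros Hne.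
          rewrite Hq, Hb, Cplus_0_l in Hx. revert Hx. apply Cmult_neq_0; trivial.
          intros H0. apply Hxb. replace x with (x - b + b) by cring. rewrite H0. cring.
      + exists []. intros x Hx. destruct Hno. now exists x. }
  destruct H as [L HL]. exists L. intros x. rewrite Hp. apply HL.
Qed.

(** Rational functions with a power of [l] as denominator. Here [l] will be the linear coefficient
    of the varied series, the only nonconstant quantity that inversions divide by; [c] is
    unconstrained where [l] vanishes. *)
Definition rational (l c : C -> C) : Prop :=
  exists p m, is_poly p /\ forall t, l t <> 0 -> c t * l t ^ m = p t.

Lemma rational_ext (l c d : C -> C) :
  (forall t, l t <> 0 -> c t = d t) -> rational l c -> rational l d.
Proof.
  intros H [p [m [Hp Hc]]]. exists p, m. split; trivial. intros t Ht.
  now rewrite <- H, Hc.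
Qed.

Lemma rational_poly l p : is_poly p -> rational l p.
Proof. intros Hp. exists p, 0%nat. split; trivial. intros t _. simpl. cring. Qed.

Lemma rational_const l c : rational l (fun _ => c).
Proof. apply rational_poly, is_poly_const. Qed.

Lemma rational_inv l : rational l (fun t => / l t).
Proof.
  exists (fun _ => 1), 1%nat. split; [apply is_poly_const|]. intros t Ht. simpl.
  now field.
Qed.

Lemma rational_mult l c d :
  rational l c -> rational l d -> rational l (fun t => c t * d t).
Proof.
  intros [p [m [Hp Hc]]] [q [n [Hq Hd]]].
  exists (fun t => p t * q t), (m + n)%nat. split; [now apply is_poly_mult|].
  intros t Ht. rewrite <- Hc, <- Hd, Cpow_add_r by trivial. cring.
Qed.

Lemma rational_plus l c d : is_poly l ->
  rational l c -> rational l d -> rational l (fun t => c t + d t).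
Proof.
  intros Hl [p [m [Hp Hc]]] [q [n [Hq Hd]]].
  exists (fun t => p t * l t ^ n + q t * l t ^ m), (m + n)%nat. split.
  - apply is_poly_plus; apply is_poly_mult; trivial; now apply is_poly_pow.
  - intros t Ht. rewrite <- Hc, <- Hd, Cpow_add_r by trivial. cring.
Qed.

Lemma rational_pow l c n : rational l c -> rational l (fun t => c t ^ n).
Proof.
  intros H. induction n as [|n IH]; [exact (rational_const l 1)|].
  exact (rational_mult _ _ _ H IH).
Qed.

Lemma rational_sum l (c : nat -> C -> C) n : is_poly l ->
  (forall k, (k <= n)%nat -> rational l (c k)) ->
  rational l (fun t => sum_n (fun k => c k t) n).
Proof.
  intros Hl H. induction n as [|n IH].
  - apply rational_ext with (c 0%nat); [|now apply H].
    intros t _. now rewrite Csum_O.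
  - apply rational_ext with (fun t => (sum_n (fun k => c k t) n : C) + c (S n) t).
    + intros t _. now rewrite Csum_S.
    + apply rational_plus; trivial; [|now apply H]. apply IH. intros; apply H; lia.
Qed.

(** Both [l] and the numerator of [c] are polynomials nonzero at [a]; their roots together form the
    list. *)
Lemma rational_zeros l c a : is_poly l -> rational l c -> l a <> 0 -> c a <> 0 ->
  exists L, forall t, ~ In t L -> l t <> 0 /\ c t <> 0.
Proof.
  intros Hl [p [m [Hp Hc]]] Hla Hca.
  destruct (is_poly_roots l a Hl Hla) as [L1 HL1].
  destruct (is_poly_roots p a Hp) as [L2 HL2].
  { rewrite <- Hc by trivial. apply Cmult_neq_0; trivial. now apply Cpow_nz. }
  exists (L1 ++ L2). intros t Ht. rewrite in_app_iff in Ht.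
  assert (Hlt : l t <> 0) by (intros H; apply Ht; left; now apply HL1).
  split; trivial. intros H0. apply Ht. right. apply HL2.
  rewrite <- Hc, H0 by trivial. cring.
Qed.

(** * Families of series with rational coefficients *)

Definition rational_fps (l : C -> C) (A : C -> fps) : Prop :=
  forall n, rational l (fun t => A t n).

Lemma rational_fps_const l F : rational_fps l (fun _ => F).
Proof. intros n. apply rational_const. Qed.

Lemma rational_fps_mul l A B : is_poly l ->
  rational_fps l A -> rational_fps l B -> rational_fps l (fun t => fps_mul (A t) (B t)).
Proof.
  intros Hl HA HB n. apply (rational_sum l (fun k t => A t k * B t (n - k)%nat)); trivial.
  intros k _. now apply rational_mult.
Qed.

Lemma rational_fps_pow l A k : is_poly l ->
  rational_fps l A -> rational_fps l (fun t => fps_pow (A t) k).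
Proof.
  intros Hl HA. induction k as [|k IH]; [exact (rational_fps_const l fps_one)|].
  now apply rational_fps_mul.
Qed.

Lemma rational_fps_comp l A B n : is_poly l ->
  (forall k, (k <= n)%nat -> rational l (fun t => A t k)) -> rational_fps l B ->
  rational l (fun t => fps_comp (A t) (B t) n).
Proof.
  intros Hl HA HB. apply (rational_sum l (fun k t => A t k * fps_pow (B t) k n)); trivial.
  intros k Hk. apply rational_mult; [now apply HA|]. now apply rational_fps_pow.
Qed.

(** Strong induction along [fps_inv_coef]. Rationality of [/ A 1] is a separate hypothesis because
    [A] will be both [h], with linear coefficient [l], and its conjugate of [g], with linear
    coefficient the constant [g 1]. *)
Lemma rational_fps_inv l A : is_poly l ->
  (forall t, l t <> 0 -> is_formal_diff (A t)) ->
  rational_fps l A -> rational l (fun t => / A t 1%nat) ->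
  rational_fps l (fun t => fps_inv (A t)).
Proof.
  intros Hl HA Hr H1 n. induction n as [n IH] using lt_wf_ind.
  apply rational_ext with (fun t => (fps_id n + (- (1)) *
     fps_comp (trunc n (fps_inv (A t))) (A t) n) * (/ A t 1%nat) ^ n).
  - intros t Ht. rewrite (fps_inv_coef (A t) n) by now apply HA. cring.
  - apply rational_mult; [|now apply rational_pow].
    apply rational_plus; trivial; [apply rational_const|].
    apply rational_mult; [apply rational_const|].
    apply rational_fps_comp with (A := fun t => trunc n (fps_inv (A t))); trivial.
    intros k _. unfold trunc. destruct (Nat.ltb_spec k n).
    + now apply IH.
    + apply rational_const.
Qed.

Lemma rational_eval l f g (h : C -> fps) W : is_poly l ->
  is_formal_diff f -> is_formal_diff g ->
  (forall t, l t <> 0 -> is_formal_diff (h t)) ->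
  (forall t, h t 1%nat = l t) -> rational_fps l h ->
  rational_fps l (fun t => eval_word f (conjug (h t) g) W).
Proof.
  intros Hl Hf Hg Hh Hh1 Hr.
  assert (Hc : rational_fps l (fun t => conjug (h t) g)).
  { intros n. apply rational_fps_comp with (A := fun t => fps_inv (h t))
      (B := fun t => fps_comp g (h t)); trivial.
    - intros k _. apply rational_fps_inv; trivial.
      apply rational_ext with (fun t => / l t); [|apply rational_inv].
      intros t _. now rewrite Hh1.
    - intros k. apply (rational_fps_comp l (fun _ => g)); trivial.
      intros; apply rational_const. }
  induction W as [|x W IH]; [exact (rational_fps_const l fps_id)|].
  intros n. apply (rational_fps_comp l (fun t => letter_val f (conjug (h t) g) x)); trivial.
  intros k _. destruct x; simpl; try apply rational_const; trivial.
  apply rational_fps_inv; trivial.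
  - intros t Ht. now apply is_formal_diff_conjug; [apply Hh|].
  - apply rational_ext with (fun _ => / g 1%nat); [|apply rational_const].
    intros t Ht. rewrite conjug_1; trivial. now apply Hh.
Qed.

(** * Avoiding countably many values *)

(** Cantor's nested intervals: the supremum of the left endpoints lies in every interval. *)
Lemma avoid_sequence (u : nat -> R) (a b : R) : (a < b)%R ->
  exists x : R, (a < x < b)%R /\ forall n, x <> u n.
Proof.
  intros Hab.
  (* The middle third keeps the limit strictly inside [(a, b)]. If [u n] is left of the midpoint the
     right half is kept, otherwise the first quarter; either closed interval misses [u n]. *)
  pose (I := fix I n := match n with
    | O => ((2 * a + b) / 3, (a + 2 * b) / 3)%R
    | S n => let p := fst (I n) in let q := snd (I n) in
        if Rlt_dec (u n) ((p + q) / 2) then ((p + q) / 2, q)%R else (p, (3 * p + q) / 4)%R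
    end).
  assert (Hlt : forall n, (fst (I n) < snd (I n))%R).
  { induction n as [|n IH]; simpl; [lra|].
    destruct (Rlt_dec _ _); simpl; lra. }
  assert (Hstep : forall n, (fst (I n) <= fst (I (S n)) /\ snd (I (S n)) <= snd (I n))%R).
  { intros n. specialize (Hlt n). simpl. destruct (Rlt_dec _ _); simpl; lra. }
  assert (Hmono : forall n k,
    (fst (I n) <= fst (I (n + k)%nat) /\ snd (I (n + k)%nat) <= snd (I n))%R).
  { intros n k. induction k as [|k IH]; [rewrite Nat.add_0_r; lra|].
    rewrite Nat.add_succ_r. specialize (Hstep (n + k)%nat). lra. }
  assert (Hcross : forall n m, (fst (I n) <= snd (I m))%R).
  { intros n m. destruct (Hmono n m) as [H1 _]. destruct (Hmono m n) as [_ H2].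
    rewrite Nat.add_comm in H2. specialize (Hlt (n + m)%nat). lra. }
  destruct (completeness (fun y => exists n, y = fst (I n))) as [x [Hub Hleast]].
  - exists (snd (I 0%nat)). intros y [n ->]. apply Hcross.
  - now exists (fst (I 0%nat)), 0%nat.
  - assert (Hx : forall n, (fst (I n) <= x <= snd (I n))%R).
    { intros n. split; [apply Hub; now exists n|].
      apply Hleast. intros y [m ->]. apply Hcross. }
    exists x. split.
    + specialize (Hx 0%nat). simpl in Hx. lra.
    + intros n Hn. generalize (Hx (S n)), (Hlt n). simpl. rewrite Hn.
      destruct (Rlt_dec _ _); simpl; lra.
Qed.

Lemma avoid_lists (L : nat -> list R) (a b : R) : (a < b)%R ->
  exists x : R, (a < x < b)%R /\ forall n, ~ In x (L n).
Proof.
  intros Hab.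
  destruct (avoid_sequence
    (fun n => nth (snd (Cantor.of_nat n)) (L (fst (Cantor.of_nat n))) 0%R) a b Hab)
    as [x [Hx Hav]].
  exists x. split; trivial. intros n Hin.
  destruct (In_nth _ _ 0%R Hin) as [j [_ Hj]].
  apply (Hav (Cantor.to_nat (n, j))). rewrite Cantor.cancel_of_to. now symmetry.
Qed.

Lemma choice {A B : Type} (P : A -> B -> Prop) :
  (forall x, exists y, P x y) -> exists F, forall x, P x (F x).
Proof.
  intros H. exists (fun x => proj1_sig (constructive_indefinite_description _ (H x))).
  intros x. apply proj2_sig.
Qed.

(** Bijective base-4 numeration with digits 1 to 4, so that words of different lengths never
    collide. *)
Fixpoint word_code (W : word) : nat :=
  match W with
  | [] => 0
  | x :: W => 1 + 4 * word_code W + match x with LA => 0 | LAinv => 1 | LB => 2 | LBinv => 3 end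
  end.

Lemma word_code_inj W W' : word_code W = word_code W' -> W = W'.
Proof.
  revert W'. induction W as [|x W IH]; intros [|y W']; simpl word_code; intros H;
    try (exfalso; lia); trivial.
  assert (E : word_code W = word_code W' /\ x = y)
    by (destruct x, y; first [exfalso; lia | split; [lia|reflexivity]]).
  destruct E as [HW ->].
  f_equal. now apply IH.
Qed.

Lemma word_enumeration : exists e : nat -> word, forall W, exists n, e n = W.
Proof.
  exists (fun n => epsilon (inhabits []) (fun W => word_code W = n)).
  intros W. exists (word_code W). apply word_code_inj.
  apply (epsilon_spec (inhabits []) (fun W' => word_code W' = word_code W)). now exists W.
Qed.

(** * Coefficientwise construction of the conjugating germ *)

Definition update (k : nat) (s : C) (h : fps) : fps :=
  fun j => if Nat.eqb j k then s else h j.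

(** The coefficients of [p] up to order [k] are the choices made so far. The completion may vary
    with the word and need not converge. *)
Definition completable (f g : fps) (N : word -> nat) (k : nat) (p : fps) : Prop :=
  forall W, reduced W -> W <> [] ->
  exists h, is_formal_diff h /\ agree k h p /\
    eval_word f (conjug h g) W (N W) <> fps_id (N W).

Lemma update_bad_values f g h W n k :
  is_formal_diff f -> is_formal_diff g -> is_formal_diff h ->
  eval_word f (conjug h g) W n <> fps_id n ->
  exists L : list C, forall s, ~ In s L ->
    is_formal_diff (update (S k) s h) /\
    eval_word f (conjug (update (S k) s h) g) W n <> fps_id n.
Proof.
  intros Hf Hg Hh Hne. set (H := fun s => update (S k) s h).
  set (l := fun s => H s 1%nat).
  assert (Hl : is_poly l).
  { unfold l, H, update. destruct k as [|k]; simpl; [apply is_poly_id|].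
    apply is_poly_const. }
  assert (HH : forall s, l s <> 0 -> is_formal_diff (H s)).
  { intros s Hs. split; [apply Hh|exact Hs]. }
  assert (Hr : rational_fps l H).
  { intros j. apply rational_poly. unfold H, update.
    destruct (Nat.eqb_spec j (S k)); [apply is_poly_id|apply is_poly_const]. }
  (* The original coefficient is a parameter value at which neither [l] nor the tested coefficient
     is degenerate. *)
  assert (Hself : H (h (S k)) = h).
  { apply functional_extensionality. intros j. unfold H, update.
    destruct (Nat.eqb_spec j (S k)) as [->|_]; reflexivity. }
  destruct (rational_zeros l (fun s => eval_word f (conjug (H s) g) W n + - fps_id n)
    (h (S k))) as [L HL]; trivial.
  - apply rational_plus; [trivial| |apply rational_const].
    now apply rational_eval.
  - unfold l. rewrite Hself. apply Hh.
  - rewrite Hself. intros E. apply Hne.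
    replace (fps_id n) with (0 + fps_id n) by cring. rewrite <- E. cring.
  - exists L. intros s Hs. destruct (HL s Hs) as [H1 H2]. split; [now apply HH|].
    intros E. apply H2. change (H s) with (update (S k) s h). rewrite E. cring.
Qed.

Lemma completable_step f g N k p (c : C) (d : R) :
  is_formal_diff f -> is_formal_diff g -> (0 < d)%R -> completable f g N k p ->
  exists x : R, (0 < x < d)%R /\ completable f g N (S k) (update (S k) (c + x) p).
Proof.
  intros Hf Hg Hd Hp.
  assert (HW : forall W, exists L : list R, forall x : R, ~ In x L -> reduced W -> W <> [] ->
    exists h, is_formal_diff h /\ agree (S k) h (update (S k) (c + x) p) /\
      eval_word f (conjug h g) W (N W) <> fps_id (N W)).
  { intros W. destruct (excluded_middle_informative (reduced W /\ W <> [])) as [[H1 H2]|Hno].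
    - destruct (Hp W H1 H2) as [h [Hh [Ha Hne]]].
      destruct (update_bad_values f g h W (N W) k Hf Hg Hh Hne) as [L HL].
      (* The offset is real, so it suffices to avoid the real parts of the bad values translated by
         [- c]. *)
      exists (map (fun z : C => (fst z - fst c)%R) L). intros x Hx _ _.
      destruct (HL (c + x)) as [HF HN].
      { intros Hin. apply Hx. apply in_map_iff. exists (c + x). split; trivial.
        destruct c. simpl. ring. }
      exists (update (S k) (c + x) h). repeat split; trivial; try apply HF.
      intros j Hj. unfold update. destruct (Nat.eqb_spec j (S k)); trivial.
      apply Ha. lia.
    - exists []. intros x _ H1 H2. destruct Hno. now split. }
  destruct (choice _ HW) as [L HL]. destruct word_enumeration as [e He].
  destruct (avoid_lists (fun n => L (e n)) 0 d Hd) as [x [Hx Hav]].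
  exists x. split; trivial. intros W HW1 HW2. apply (HL W x); trivial.
  destruct (He W) as [n <-]. apply Hav.
Qed.

(** Iterating the step gives prefixes [P k]. Later updates touch only orders above [k], so the
    diagonal series agrees with [P k] up to order [k] and inherits its completions. *)
Lemma completable_limit f g N (phi : fps) (d : nat -> R) :
  is_formal_diff f -> is_formal_diff g -> (forall n, (0 < d n)%R) ->
  completable f g N 0 (fun _ => 0) ->
  exists h : fps, h 0%nat = 0 /\
    (forall n, exists x : R, (0 < x < d (S n))%R /\ h (S n) = phi (S n) + x) /\
    (forall k, completable f g N k h).
Proof.
  intros Hf Hg Hd H0.
  (* Completability is a premise inside the relation, so that [T] is total; on other prefixes it
     takes an arbitrary value. *)
  destruct (choice (fun (kp : nat * fps) (x : R) =>
    completable f g N (fst kp) (snd kp) -> (0 < x < d (S (fst kp)))%R /\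
    completable f g N (S (fst kp)) (update (S (fst kp)) (phi (S (fst kp)) + x) (snd kp))))
    as [T HT].
  { intros [k p]. simpl.
    destruct (excluded_middle_informative (completable f g N k p)) as [Hc|Hc].
    - destruct (completable_step f g N k p (phi (S k)) (d (S k)) Hf Hg (Hd _) Hc) as [x Hx].
      now exists x.
    - exists 0%R. intros H. now destruct Hc. }
  pose (P := fix P n : fps := match n with
    | O => fun _ => RtoC 0
    | S k => update (S k) (phi (S k) + T (k, P k)) (P k) end).
  assert (HP : forall k, completable f g N k (P k)).
  { induction k as [|k IH]; [exact H0|]. apply (HT (k, P k)), IH. }
  exists (fun n => P n n). split; [reflexivity|split].
  - intros n. exists (T (n, P n)). split; [apply (HT (n, P n)), HP|].
    simpl. unfold update. now rewrite Nat.eqb_refl.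
  - intros k W HW1 HW2. destruct (HP k W HW1 HW2) as [h [Hh [Ha Hne]]].
    exists h. repeat split; trivial; try apply Hh. intros j Hj. rewrite Ha by trivial.
    clear - Hj. induction k as [|k IH]; [now replace j with 0%nat by lia|].
    destruct (Nat.eq_dec j (S k)) as [->|Hne]; trivial.
    rewrite <- IH by lia. simpl. unfold update.
    destruct (Nat.eqb_spec j (S k)); [contradiction|reflexivity].
Qed.

Lemma completable_start f g : is_formal_diff g -> no_universal_relation f g ->
  exists N, completable f g N 0 (fun _ => 0).
Proof.
  intros Hg Hno.
  assert (H : forall W, exists n, reduced W -> W <> [] -> exists h,
    is_formal_diff h /\ agree 0 h (fun _ => 0) /\ eval_word f (conjug h g) W n <> fps_id n).
  { intros W. apply NNPP. intros HnW.
    assert (HW : reduced W /\ W <> []).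
    { apply NNPP. intros Hc. apply HnW. exists 0%nat. intros H1 H2. now destruct Hc. }
    assert (Hall : forall h, is_formal_diff h -> eval_word f (conjug h g) W = fps_id).
    { intros h Hh. apply functional_extensionality. intros n. apply NNPP. intros Hne.
      apply HnW. exists n. intros _ _. exists h. repeat split; trivial; try apply Hh.
      intros j Hj. replace j with 0%nat by lia. apply Hh. }
    apply (Hno W). repeat split; try apply HW; trivial.
    (* A universal relation must also hold for the pair [f], [g] itself: this is conjugation by the
       identity. *)
    rewrite <- (conjug_id g Hg). apply Hall, is_formal_diff_id. }
  destruct (choice _ H) as [N HN]. exists N. exact HN.
Qed.

(** Any nonempty reduced word, here [[LA]], supplies a completion, which has the same nonzero linear
    coefficient as [h]. *)
Lemma completable_formal_diff f g N (h : fps) : h 0%nat = 0 ->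
  completable f g N 1 h -> is_formal_diff h.
Proof.
  intros H0 Hc. destruct (Hc [LA]) as [h' [Hh' [Ha _]]]; [easy|easy|].
  split; trivial. rewrite <- Ha by lia. apply Hh'.
Qed.

Lemma completable_free_pair f g N h : is_formal_diff g -> is_formal_diff h ->
  (forall k, completable f g N k h) -> free_pair f (conjug h g).
Proof.
  intros Hg Hh Hc W HW1 HW2 E.
  destruct (Hc (N W) W HW1 HW2) as [h' [Hh' [Ha Hne]]]. apply Hne.
  rewrite <- E. apply agree_eval with (N W); trivial; try now apply is_formal_diff_conjug.
  now apply agree_conjug.
Qed.

(** * Convergence *)

(** On the disc of radius [r] these weights give a geometric majorant of sum [e / 2], strictly below
    [e] as the ball requires. *)
Definition radius_weight (r e : R) (n : nat) : R := (e / 4 * (1 / 2) ^ n / r ^ n)%R.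

Lemma series_radius_weight (r e : R) (d : fps) (z : C) : (0 < r)%R -> (0 < e)%R ->
  (forall n, (Cmod (d n) <= radius_weight r e n)%R) -> (Cmod z < r)%R ->
  (exists l, series_at d z l) /\ forall l, series_at d z l -> (Cmod l <= e / 2)%R.
Proof.
  intros Hr He Hd Hz.
  assert (Hb : is_series (fun n => (e / 4 * (1 / 2) ^ n)%R) (e / 2)%R).
  { replace (e / 2)%R with (e / 4 * (/ (1 - 1 / 2)))%R by field.
    apply (is_series_scal_l (K := R_AbsRing) (V := R_NormedModule) (e / 4)%R
      (fun n => ((1 / 2) ^ n)%R) (/ (1 - 1 / 2))%R).
    apply is_series_geom. rewrite Rabs_pos_eq; lra. }
  assert (Hterm : forall n, (Cmod (d n * z ^ n) <= e / 4 * (1 / 2) ^ n)%R).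
  { intros n. rewrite Cmod_mult, Cmod_pow.
    apply Rle_trans with (radius_weight r e n * r ^ n)%R.
    - apply Rmult_le_compat; trivial; try apply Cmod_ge_0.
      + apply pow_le, Cmod_ge_0.
      + apply pow_incr. split; [apply Cmod_ge_0|lra].
    - right. unfold radius_weight. field. apply pow_nonzero. lra. }
  split.
  - apply (ex_series_le (K := C_AbsRing) (V := C_CompleteNormedModule) _ _ Hterm).
    now exists (e / 2)%R.
  - intros l Hl.
    apply (is_lim_seq_le (fun n => Cmod (sum_n (fun n => d n * z ^ n) n))
      (sum_n (fun n => (e / 4 * (1 / 2) ^ n)%R)) (Cmod l) (e / 2)%R); trivial.
    + intros n. eapply Rle_trans.
      * apply (norm_sum_n_m (K := C_AbsRing) (V := C_NormedModule)).
      * apply sum_n_m_le. exact Hterm.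
    + eapply filterlim_comp; [exact Hl|].
      apply (filterlim_norm (K := C_AbsRing) (V := C_NormedModule)).
Qed.

Lemma analytic_ball_radius_weight (phi h : fps) (r e : R) : (0 < r)%R -> (0 < e)%R ->
  (forall n, (Cmod (h n - phi n) <= radius_weight r e n)%R) -> analytic_ball phi r e h.
Proof.
  intros Hr He Hd. split.
  - intros z Hz. now apply (series_radius_weight r e).
  - exists (e / 2)%R. split; [lra|]. intros z l Hz. now apply (series_radius_weight r e).
Qed.

(** Both [phi] and [h - phi] converge on the smaller of the two discs, hence so does their sum. *)
Lemma is_germ_analytic_ball (phi h : fps) (r e : R) : (0 < r)%R ->
  is_germ phi -> is_formal_diff h -> analytic_ball phi r e h -> is_germ h.
Proof.
  intros Hr [_ [rho [Hrho Hphi]]] Hh [Hd _]. split; trivial.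
  exists (Rmin rho r). split; [now apply Rmin_glb_lt|]. intros z Hz.
  destruct (Hphi z) as [l1 H1]; [eapply Rlt_le_trans; [exact Hz|apply Rmin_l]|].
  destruct (Hd z) as [l2 H2]; [eapply Rlt_le_trans; [exact Hz|apply Rmin_r]|].
  exists (l1 + l2). unfold series_at.
  eapply is_series_ext; [|exact (is_series_plus _ _ _ _ H1 H2)].
  intros n. change (phi n * z ^ n + (h n - phi n) * z ^ n = h n * z ^ n). cring.
Qed.

Theorem theorem2p6 (f g : fps) :
  is_germ f -> is_germ g -> f <> fps_id -> g <> fps_id ->
  no_universal_relation f g ->
  exists U : fps -> Prop,
    (forall h, U h -> is_germ h) /\
    analytic_dense U /\
    (forall h, U h -> free_pair f (conjug h g)).
Proof.
  intros [Hf _] [Hg _] _ _ Hno.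
  (* The largest admissible set is taken, so that only density remains to be proved. *)
  exists (fun h => is_germ h /\ free_pair f (conjug h g)).
  split; [now intros h []|split; [|now intros h []]].
  intros phi r e Hphi Hr He.
  destruct (completable_start f g Hg Hno) as [N HN].
  destruct (completable_limit f g N phi (radius_weight r e)) as [h [H0 [Hclose Hc]]];
    trivial.
  { intros n. unfold radius_weight. assert (0 < r ^ n)%R by now apply pow_lt.
    assert (0 < (1 / 2) ^ n)%R by (apply pow_lt; lra).
    apply Rdiv_lt_0_compat; trivial. apply Rmult_lt_0_compat; lra. }
  assert (Hh : is_formal_diff h) by now apply (completable_formal_diff f g N).
  assert (Hball : analytic_ball phi r e h).
  { apply analytic_ball_radius_weight; trivial. intros [|n].
    (* Offsets start at order 1; at order 0 both series vanish. *)
    - rewrite H0. destruct Hphi as [[-> _] _].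
      replace (0 - 0) with (RtoC 0) by cring. rewrite Cmod_0.
      unfold radius_weight. simpl. lra.
    - destruct (Hclose n) as [x [Hx ->]].
      replace (phi (S n) + x - phi (S n)) with (RtoC x) by cring.
      rewrite Cmod_R, Rabs_pos_eq; lra. }
  assert (Hgerm : is_germ h) by now apply (is_germ_analytic_ball phi h r e).
  exists h. repeat split; trivial; try apply Hgerm; try apply Hball.
  now apply (completable_free_pair f g N).
Qed.
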